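(* Let $V$ be an infinite-dimensional vector space over a field $K$ and let $\varphi$ be an endomorphism of $V$. Then every subspace $H\le V$ has finite codimension in $H+\varphi(H)$ if and only if $\varphi$ acts as multiplication by a scalar of $K$ on some subspace of finite codimension in $V$. On the other hand, for every subspace $H\le V$ the codimension of $H\cap\varphi(H)$ in $H$ is finite if and only if $\varphi$ acts as multiplication by a non-zero scalar on some subspace of finite codimension in $V$.
   Context: ''Endomorphism of $V$'' means $K$-linear endomorphism. ''$\varphi$ acts as multiplication by a scalar $k\in K$ on a subspace $W$'' means $\varphi(w)=kw$ for all $w\in W$. *)

(* Defs.v *)
From mathcomp Require Import all_boot all_algebra.
From mathcomp Require Import boolp classical_sets.

Set Implicit Arguments.
Unset Strict Implicit.
Unset Printing Implicit Defensive.

Import GRing.Theory.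

Local Open Scope classical_set_scope.
Local Open Scope ring_scope.

(* Vector spaces may be infinite-dimensional, so subspaces cannot be taken in
   {vspace V}; they are arbitrary classical sets. *)
Definition subspace (K : fieldType) (V : lmodType K) (H : set V) : Prop :=
  GRing.submod_closed (mem H).

Definition finite_dim (K : fieldType) (V : lmodType K) : Prop :=
  exists (n : nat) (v : 'I_n -> V),
    forall x : V, exists c : 'I_n -> K, x = \sum_(i < n) c i *: v i.

Definition addsp (K : fieldType) (V : lmodType K) (A B : set V) : set V :=
  [set x + y | x in A & y in B].

(* For subspaces H `<=` W: the quotient W / H is spanned by the classes of
   finitely many vectors w i of W. *)
Definition finite_codim (K : fieldType) (V : lmodType K) (H W : set V) : Prop :=
  H `<=` W /\
  exists (n : nat) (w : 'I_n -> V),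
    (forall i, W (w i)) /\
    forall x, W x ->
      exists c : 'I_n -> K, H (x - \sum_(i < n) c i *: w i).

Definition acts_as_scalar (K : fieldType) (V : lmodType K)
    (phi : V -> V) (k : K) (W : set V) : Prop :=
  forall w, W w -> phi w = k *: w.

(* Main.v *)
Require Import Defs.
From mathcomp Require Import all_boot all_algebra.
From mathcomp Require Import boolp classical_sets.

Set Implicit Arguments.
Unset Strict Implicit.
Unset Printing Implicit Defensive.

Local Open Scope classical_set_scope.
Local Open Scope ring_scope.

Import GRing.Theory.

(** Call a subspace [H] displaced when [phi] is injective on [H] and [H] meets
    [phi(H)] only in 0. For such an [H] both codimensions of the statement equal
    the dimension of [H]: the quotient of [H + phi(H)] by [H] is [phi(H)], which
    is isomorphic to [H], and [H] modulo its intersection with [phi(H)] is [H]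
    itself. So either finiteness hypothesis makes every displaced subspace
    finite-dimensional.

    By Zorn's lemma there is a maximal displaced subspace [H]
    ([exists_maximal_displaced]), and then [F = H + phi(H)] is
    finite-dimensional. Maximality forces every [x] outside [F] to be an
    eigenvector of [phi] modulo [F]: since [H + Kx] is no longer displaced, some
    [h] in it has its image in it too, and solving for [phi x] puts
    [phi x] in [Kx + F] ([scalar_mod_eigenline]). A linear map for which all
    vectors are eigenvectors is a scalar, and since [V / F] has dimension at
    least 2 this argument still works modulo [F] ([scalar_mod]). Hence
    [phi - k] has finite-dimensional image inside [F] for some [k], so that its
    kernel, on which [phi] is multiplication by [k], has finite codimension
    ([scalar_on_finite_codim]).

    In the second equivalence the scalar is non-zero: if [phi] killed a subspace
    [U] of finite codimension, then the intersection of [U] and [phi(U)] would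
    be 0, and [U], hence [V], would be finite-dimensional ([scalar_neq0]).

    For the converses, [H] meets the subspace where [phi] is a scalar in a
    subspace [H'] of finite codimension in [H]. The image of [H'] lies in [H],
    so finitely many vectors generate [phi(H)] modulo [H]; and when [k != 0] the
    image of [H'] is [H'], which therefore lies in both [H] and [phi(H)]. *)

(** * Subspaces and finite spans *)

Section Subspaces.
Context {K : fieldType} {V : lmodType K}.
Implicit Types (A B M N H U : set V) (s t : seq V) (x y v : V) (a c : K).

Lemma subspaceP H :
  subspace H <-> H 0 /\ forall a x y, H x -> H y -> H (a *: x + y).
Proof.
split=> [[H0 HL]|[H0 HL]].
  split=> [|a x y Hx Hy]; first by move: H0; rewrite inE.
  by have := HL a x y; rewrite !inE; apply.
by split=> [|a x y]; rewrite !inE //; apply: HL.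
Qed.

Lemma subspace0 {H} : subspace H -> H 0.
Proof. by case/subspaceP. Qed.

Lemma subspaceZD {H} a x y : subspace H -> H x -> H y -> H (a *: x + y).
Proof. by case/subspaceP=> _; apply. Qed.

Lemma subspaceD {H} x y : subspace H -> H x -> H y -> H (x + y).
Proof. by move=> sH Hx Hy; rewrite -[x]scale1r; apply: subspaceZD. Qed.

Lemma subspaceZ {H} a x : subspace H -> H x -> H (a *: x).
Proof.
move=> sH Hx; rewrite -[_ *: _]addr0; apply: subspaceZD => //.
exact: subspace0.
Qed.

Lemma subspaceB {H} x y : subspace H -> H x -> H y -> H (x - y).
Proof.
by move=> sH Hx Hy; rewrite addrC -scaleN1r; apply: subspaceZD.
Qed.

Lemma subspace_zero : subspace [set 0 : V].
Proof.
by apply/subspaceP; split=> // a x y -> ->; rewrite /= scaler0 addr0.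
Qed.

Lemma subspaceI A B : subspace A -> subspace B -> subspace (A `&` B).
Proof.
move=> sA sB; apply/subspaceP; split; first by split; apply: subspace0.
by move=> a x y [Ax Bx] [Ay By]; split; apply: subspaceZD.
Qed.

Lemma subspace_addsp A B : subspace A -> subspace B -> subspace (addsp A B).
Proof.
move=> sA sB; apply/subspaceP; split.
  by exists 0; [exact: subspace0|exists 0; [exact: subspace0|rewrite addr0]].
move=> a _ _ [x Ax [x' Bx' <-]] [y Ay [y' By' <-]].
exists (a *: x + y); first exact: subspaceZD.
exists (a *: x' + y'); first exact: subspaceZD.
by rewrite scalerDr addrACA.
Qed.

Lemma addsp_subl A B : subspace B -> A `<=` addsp A B.
Proof.
by move=> sB x Ax; exists x => //; exists 0; [exact: subspace0|rewrite addr0].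
Qed.

Lemma addsp_subr A B : subspace A -> B `<=` addsp A B.
Proof.
by move=> sA x Bx; exists 0; [exact: subspace0|exists x => //; rewrite add0r].
Qed.

Definition adjoin v M : set V := [set x | exists c, M (x - c *: v)].

(** The sum of [N] and the span of [s]. Adjoining the vectors one at a time
    makes every fact about finite spans a list induction, with no coefficient
    families to reindex. *)
Definition hull N s : set V := foldr adjoin N s.

Lemma subspace_adjoin v M : subspace M -> subspace (adjoin v M).
Proof.
move=> sM; apply/subspaceP; split.
  by exists 0; rewrite scale0r subr0; apply: subspace0.
move=> a x y [c Mx] [d My]; exists (a * c + d).
have -> : a *: x + y - (a * c + d) *: v = a *: (x - c *: v) + (y - d *: v).
  by rewrite scalerBr scalerA scalerDl opprD addrACA.
exact: subspaceZD.
Qed.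

Lemma sub_adjoin v M : M `<=` adjoin v M.
Proof. by move=> x Mx; exists 0; rewrite scale0r subr0. Qed.

Lemma mem_adjoin v M : subspace M -> adjoin v M v.
Proof. by move=> sM; exists 1; rewrite scale1r subrr; apply: subspace0. Qed.

Lemma subspace_hull N s : subspace N -> subspace (hull N s).
Proof. by move=> sN; elim: s => //= v s; apply: subspace_adjoin. Qed.

Lemma sub_hull N s : N `<=` hull N s.
Proof. by elim: s => //= v s IHs x /IHs; apply: sub_adjoin. Qed.

Lemma hull_cat N s t : hull N (s ++ t) = hull (hull N t) s.
Proof. exact: foldr_cat. Qed.

Lemma hull_mono M N s : M `<=` N -> hull M s `<=` hull N s.
Proof. by move=> MN; elim: s => //= v s IHs x [c /IHs]; exists c. Qed.

(** The only place where coefficient families and hulls meet; it translates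
    [finite_codim] and [finite_dim] into hulls of lists. *)
Lemma hull_codom N n (w : 'I_n -> V) x :
  hull N (codom w) x <-> exists c : 'I_n -> K, N (x - \sum_(i < n) c i *: w i).
Proof.
elim: n w x => [|n IHn] w x.
  rewrite codomE enum_ord0 /=; split=> [Nx|[c]]; last by rewrite big_ord0 subr0.
  by exists (fun=> 0); rewrite big_ord0 subr0.
have -> : codom w = w ord0 :: codom (fun i => w (lift ord0 i)).
  by rewrite !codomE enum_ordSl /= -map_comp.
split=> [[c /IHn[d Nx]]|[c]].
  exists (fun i => if unlift ord0 i is Some j then d j else c).
  rewrite big_ord_recl unlift_none opprD addrA.
  by under eq_bigr do rewrite liftK.
rewrite big_ord_recl opprD addrA => Nx; exists (c ord0); apply/IHn.
by exists (fun i => c (lift ord0 i)).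
Qed.

Lemma finite_codimP H U :
  finite_codim H U <->
  H `<=` U /\ exists2 s, {in s, forall v, U v} & U `<=` hull H s.
Proof.
split=> [[HU [n [w [Uw Ush]]]]|[HU [s Us Ush]]]; split=> //.
  exists (codom w) => [v /codomP[i ->] //|x /Ush ?]; exact/hull_codom.
exists (size s), (tnth (in_tuple s)); split=> [i|x /Ush].
  exact/Us/mem_tnth.
have {1}-> : s = codom (tnth (in_tuple s)) by rewrite codomE map_tnth_enum.
by move/hull_codom.
Qed.

Lemma finite_dim_hull s : (forall x, hull [set 0] s x) -> finite_dim V.
Proof.
move=> hs; exists (size s), (tnth (in_tuple s)) => x.
have /hull_codom[c /eqP] : hull [set 0] (codom (tnth (in_tuple s))) x.
  by rewrite codomE map_tnth_enum.
by rewrite subr_eq0 => /eqP; exists c.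
Qed.

(** A subspace of a finite-dimensional space is finite-dimensional, relative
    to [N]. Only the case of one more generator [v] matters: either [H] stays in
    the hull of the other generators, or some [z] in [H] leaves it and can
    replace [v]. *)
Lemma hull_generators_in N H s : subspace N -> subspace H ->
  H `<=` hull N s -> exists2 t, {in t, forall v, H v} & H `<=` hull N t.
Proof.
move=> sN; elim: s H => [|v s IHs] H sH Hs; first by exists [::].
set M := hull N s in Hs *; have sM : subspace M by exact: subspace_hull.
have [t Ht HMt] : exists2 t, {in t, forall v, (H `&` M) v} &
    H `&` M `<=` hull N t.
  by apply: IHs; [exact: subspaceI|exact: subIsetr].
have [HM|/existsNP[z /not_implyP[Hz nMz]]] := pselect (H `<=` M).
  by exists t => [u /Ht[]|x Hx] //; apply: HMt; split=> //; apply: HM.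
have [c Mz] := Hs _ Hz.
have c0 : c != 0.
  by apply: contra_notN nMz => /eqP c0; move: Mz; rewrite c0 scale0r subr0.
exists (z :: t) => [u|x Hx].
  by rewrite inE => /predU1P[->|/Ht[]].
have [d Mx] := Hs _ Hx.
exists (d / c); apply: HMt; split.
  by apply: subspaceB => //; apply: subspaceZ.
have -> : x - (d / c) *: z = (x - d *: v) - (d / c) *: (z - c *: v).
  by rewrite scalerBr scalerA divfK // opprB addrA subrK.
by apply: subspaceB => //; apply: subspaceZ.
Qed.

(** The modular law: intersecting [U] plus the span of [t] with a subspace [H]
    that contains [t] only affects [U]. *)
Lemma hull_modular U H t x : subspace H -> {in t, forall v, H v} ->
  H x -> hull U t x -> hull (U `&` H) t x.
Proof.
move=> sH; elim: t x => [//|v t IHt] x Ht Hx [c hx].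
exists c; apply: IHt hx; first by move=> u ut; apply: Ht; rewrite inE ut orbT.
apply: subspaceB => //; apply: subspaceZ => //; exact/Ht/mem_head.
Qed.

Lemma finite_codimI U H : subspace U -> subspace H ->
  finite_codim U setT -> finite_codim (U `&` H) H.
Proof.
move=> sU sH /finite_codimP[_ [s _ Us]]; apply/finite_codimP; split=> [x []//|].
have [t Ht HUt] := hull_generators_in sU sH (fun x _ => Us x I).
by exists t => // x Hx; apply: hull_modular (HUt x Hx).
Qed.

Lemma finite_codim_subl A B H : A `<=` B -> B `<=` H ->
  finite_codim A H -> finite_codim B H.
Proof.
move=> AB BH /finite_codimP[_ [s Hs HAs]]; apply/finite_codimP; split=> //.
by exists s => // x /HAs; apply: hull_mono.
Qed.

End Subspaces.

(** * Images and kernels of linear maps *)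

Section LinearMaps.
Context {K : fieldType} {V W : lmodType K} (f : {linear V -> W}).
Implicit Types (N H : set V) (s : seq V) (x : V).

Lemma subspace_image H : subspace H -> subspace (f @` H).
Proof.
move=> sH; apply/subspaceP; split.
  by exists 0; [apply: subspace0|rewrite linear0].
move=> a _ _ [x Hx <-] [y Hy <-]; exists (a *: x + y); last by rewrite linearP.
exact: subspaceZD.
Qed.

Lemma hull_image N s x :
  hull N s x -> hull (f @` N) (map f s) (f x).
Proof.
elim: s x => [x Nx|v s IHs x [c /IHs]]; first by exists x.
by rewrite linearB linearZ; exists c.
Qed.

(** The image of [f] is generated by finitely many values [f u]. Writing [f x]
    on them and subtracting the same combination of the vectors [u] from [x]
    gives an element of the kernel. *)
Lemma finite_codim_kernel (s : seq W) :
  (forall x, hull [set 0] s (f x)) -> finite_codim [set x | f x = 0] setT.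
Proof.
move=> fs; apply/finite_codimP; split=> //.
have sT : subspace (f @` setT).
  by apply: subspace_image; apply/subspaceP; split.
have [|t tf] := hull_generators_in (s := s) subspace_zero sT.
  by move=> _ [x _ <-].
have [u ->] : exists u, t = map f u.
  elim: t tf => [|v t IHt] tf; first by exists [::].
  have [|u ->] := IHt; first by move=> w wt; apply: tf; rewrite inE wt orbT.
  have [y _ <-] := tf v (mem_head _ _).
  by exists (y :: u).
move=> fu; exists u => // x _; have := fu (f x) (imageT f x).
elim: u x {fu} => [x //|v u IHu x [c]].
by rewrite -linearZ -linearB => /IHu ?; exists c.
Qed.

End LinearMaps.

(** * Displaced subspaces and the scalar *)

Section Endomorphism.
Context {K : fieldType} {V : lmodType K} (phi : {linear V -> V}).
Implicit Types (F H U : set V) (x y : V) (k c : K).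

(** The single implication packs two conditions: [phi] is injective on [H], and
    [H] meets [phi @` H] only in 0. In this form it passes to unions of
    chains. *)
Definition displaced H := forall h, H h -> H (phi h) -> h = 0.

Lemma exists_maximal_displaced :
  exists H, [/\ subspace H, displaced H &
    forall B, subspace B -> displaced B -> H `<=` B -> B `<=` H].
Proof.
(* Membership of 0 is left out of [P] because the union of the empty chain is
   empty; a maximal element contains 0 anyway, since {0} is displaced. *)
pose P : set (set V) := [set H |
  (forall a x y, H x -> H y -> H (a *: x + y)) /\ displaced H].
have [|H [[Hlin Hd] Hmax]] := @Zorn_bigcup V P.
  move=> C CP Ctot; split.
    move=> a x y [A CA Ax] [B CB By].
    have [AB|BA] := Ctot A B CA CB.
      by exists B => //; apply: (CP B CB).1 => //; apply: AB.
    by exists A => //; apply: (CP A CA).1 => //; apply: BA.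
  move=> h [A CA Ah] [B CB Bh].
  have [AB|BA] := Ctot A B CA CB.
    by apply: (CP B CB).2 => //; apply: AB.
  by apply: (CP A CA).2 => //; apply: BA.
have maxH B : subspace B -> displaced B -> H `<=` B -> B `<=` H.
  move=> sB Bd HB; apply: contrapT => nBH; apply: (Hmax B) => //.
  by split=> // a x y; apply: subspaceZD.
exists H; split=> //; apply/subspaceP; split=> //.
have [[x Hx]|/forallNP He] := pselect (exists x, H x).
  by rewrite -(addNr x) -scaleN1r; apply: Hlin.
apply: (maxH [set 0]) => //; first exact: subspace_zero.
by move=> x /He.
Qed.

(** As [adjoin x H] is not displaced, it contains some [h != 0] with
    [h = c x] and [phi h = d x] modulo [H]. If [c] were 0 then [h] would lie in
    [H]: then [d != 0] would put [x] in [H + phi(H)], and [d = 0] would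
    contradict that [H] is displaced. So [c != 0], and the scalar is
    [d / c]. *)
Lemma scalar_mod_eigenline H x :
  subspace H -> displaced H ->
  (forall B, subspace B -> displaced B -> H `<=` B -> B `<=` H) ->
  ~ addsp H (phi @` H) x -> exists k, addsp H (phi @` H) (phi x - k *: x).
Proof.
set F := addsp H (phi @` H) => sH Hd Hmax nFx.
have sF : subspace F by apply: subspace_addsp => //; exact: subspace_image.
have HF : H `<=` F by apply: addsp_subl; exact: subspace_image.
have pHF h : H h -> F (phi h).
  by move=> Hh; apply: (addsp_subr sH); exists h.
have nBd : ~ displaced (adjoin x H).
  move=> Bd; apply/nFx/HF/(Hmax (adjoin x H)) => //.
  - exact: subspace_adjoin.
  - exact: sub_adjoin.
  - exact: mem_adjoin.
have /existsNP[h /not_implyP[[c Hc] /not_implyP[[d Hd'] h0]]] := nBd.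
have [c0|c0] := eqVneq c 0.
  exfalso; move: Hc; rewrite c0 scale0r subr0 => Hh.
  have [d0|d0] := eqVneq d 0.
    by move: Hd'; rewrite d0 scale0r subr0 => /(Hd h Hh).
  apply: nFx; have -> : x = d^-1 *: (phi h - (phi h - d *: x)).
    by rewrite opprB addrC subrK scalerA mulVf // scale1r.
  apply: subspaceZ => //; apply: subspaceB => //; first exact: pHF.
  exact: HF.
exists (d / c).
have -> : phi x - (d / c) *: x = c^-1 *: ((phi h - d *: x) - phi (h - c *: x)).
  have -> : phi (h - c *: x) = phi h - c *: phi x by rewrite linearB linearZ.
  rewrite opprB (addrC (_ - d *: x)) addrA subrK scalerBr !scalerA mulVf //.
  by rewrite scale1r mulrC.
apply: subspaceZ => //; apply: subspaceB => //; first exact: HF.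
exact: pHF.
Qed.

(** A map for which all vectors are eigenvectors is a scalar, read modulo [F]:
    comparing the eigenvalues of [x0], [y] and [x0 + y] shows that [y] has the
    eigenvalue of [x0] as soon as the two are independent modulo [F]. The
    remaining vectors, those of [adjoin x0 F], are differences of two vectors
    outside [adjoin x0 F]. *)
Lemma scalar_mod F : subspace F ->
  (forall x, exists z, ~ adjoin x F z) ->
  (forall x, ~ F x -> exists k, F (phi x - k *: x)) ->
  exists k, forall x, F (phi x - k *: x).
Proof.
move=> sF bigF eig.
have [x0 nFx0] : exists x, ~ F x.
  by have [z nz] := bigF 0; exists z => /sub_adjoin.
have [k Fk] := eig x0 nFx0.
have out y : ~ adjoin x0 F y -> F (phi y - k *: y).
  move=> ny.
  have nFy : ~ F y by move=> /sub_adjoin.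
  have nFxy : ~ F (x0 + y).
    by move=> Fxy; apply: ny; exists (-1); rewrite scaleN1r opprK addrC.
  have [l Fl] := eig _ nFy.
  have [m Fm] := eig _ nFxy.
  have Fc : F ((m - k) *: x0 + (m - l) *: y).
    have -> : (m - k) *: x0 + (m - l) *: y =
        (phi x0 - k *: x0) + (phi y - l *: y) - (phi (x0 + y) - m *: (x0 + y)).
      rewrite (linearD phi) opprB scalerDr [X in _ = X + _]addrACA -opprD.
      by rewrite [RHS]addrC addrA subrK opprD addrACA -!scalerBl.
    by apply: subspaceB => //; apply: subspaceD.
  have ml : m = l.
    apply/eqP; rewrite -subr_eq0; apply: contra_notT ny => ml.
    exists (- (m - l)^-1 * (m - k)).
    have -> : y - (- (m - l)^-1 * (m - k)) *: x0 =
        (m - l)^-1 *: ((m - k) *: x0 + (m - l) *: y).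
      by rewrite scalerDr !scalerA mulVf // scale1r mulNr scaleNr opprK addrC.
    exact: subspaceZ.
  have mk : m = k.
    apply/eqP; rewrite -subr_eq0; apply: contra_notT nFx0 => mk.
    have -> : x0 = (m - k)^-1 *: ((m - k) *: x0 + (m - l) *: y).
      by rewrite -ml subrr scale0r addr0 scalerA mulVf // scale1r.
    exact: subspaceZ.
  by rewrite -mk ml.
exists k => y; have [yin|] := pselect (adjoin x0 F y); last exact: out.
have [z nz] := bigF x0.
have nzy : ~ adjoin x0 F (z + y).
  move=> zy; apply: nz; rewrite -(addrK y z).
  by apply: subspaceB => //; apply: subspace_adjoin.
have -> : phi y - k *: y = (phi (z + y) - k *: (z + y)) - (phi z - k *: z).
  rewrite (linearD phi) scalerDr opprD addrACA.
  by rewrite [RHS]addrAC subrr add0r.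
by apply: subspaceB => //; apply: out.
Qed.

Lemma scalar_on_finite_codim :
  ~ finite_dim V ->
  (forall H, subspace H -> displaced H -> exists s, H `<=` hull [set 0] s) ->
  exists k U, [/\ subspace U, finite_codim U setT & acts_as_scalar phi k U].
Proof.
move=> infV fdd; have [H [sH Hd Hmax]] := exists_maximal_displaced.
have [s Hs] := fdd H sH Hd.
set F := addsp H (phi @` H).
have sF : subspace F by apply: subspace_addsp => //; exact: subspace_image.
have Fs : F `<=` hull [set 0] (map phi s ++ s).
  move=> _ [x /Hs xs [_ [y /Hs ys <-] <-]].
  rewrite hull_cat; apply: subspaceD.
  - by do 2!apply: subspace_hull; exact: subspace_zero.
  - exact: sub_hull.
  apply: hull_mono (hull_image phi ys) => _ [_ -> <-]; rewrite linear0.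
  by apply/subspace0/subspace_hull/subspace_zero.
have bigF x : exists z, ~ adjoin x F z.
  apply/existsNP => Fx; apply/infV.
  apply: (@finite_dim_hull _ _ (x :: map phi s ++ s)) => z.
  by have [c /Fs] := Fx z; exists c.
have [k Fk] := scalar_mod sF bigF (fun x => scalar_mod_eigenline sH Hd Hmax).
exists k, [set x | phi x = k *: x]; split => //.
  apply/subspaceP; split=> [|a x y]; rewrite /= ?linear0 ?scaler0 // => xk yk.
  by rewrite linearP /= xk yk scalerDr !scalerA mulrC.
have -> : [set x | phi x = k *: x] = [set x | (phi \- k \*: idfun) x = 0].
  apply/seteqP; split=> x /=; first by move=> ->; rewrite subrr.
  by move/eqP; rewrite subr_eq0 => /eqP.
apply: (finite_codim_kernel (s := map phi s ++ s)) => x.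
by apply: Fs; apply: Fk.
Qed.

(** The quotient of [H + phi(H)] by [H] has generators of the form [phi b] with
    [b] in [H]. Writing [phi x] on them gives a combination [y] of the vectors
    [b] with [phi (x - y)] in [H], so that [x = y] because [H] is displaced. *)
Lemma displaced_finite_of_add H : displaced H ->
  finite_codim H (addsp H (phi @` H)) -> subspace H ->
  exists s, H `<=` hull [set 0] s.
Proof.
move=> Hd /finite_codimP[_ [s sF Fs]] sH.
have [t Ht FHt] : exists2 t, {in t, forall v, H v} &
    addsp H (phi @` H) `<=` hull H (map phi t).
  (* A generator [a + phi b] may be replaced by [phi b], since [H] contains
     [a]; the induction treats the space generated as arbitrary. *)
  elim: s sF (addsp _ _) Fs => [_ F FH|v s IHs sF F Fs]; first by exists [::].
  have [||t Ht Mt] := IHs _ (hull H s) => //.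
    by move=> u us; apply: sF; rewrite inE us orbT.
  have [a Ha [_ [b Hb <-] vab]] := sF v (mem_head _ _).
  exists (b :: t) => [u|x /Fs[c /Mt xc]].
    by rewrite inE => /predU1P[->|/Ht].
  exists c; have -> : x - c *: phi b = x - c *: v + c *: a.
    by rewrite -vab scalerDr opprD -addrA (addrAC (- (c *: a))) addNr add0r.
  apply: subspaceD => //; first exact: subspace_hull.
  apply: subspaceZ; first exact: subspace_hull.
  exact: sub_hull.
exists t => x Hx.
have : hull H (map phi t) (phi x) by apply/FHt/(addsp_subr sH); exists x.
elim: t Ht x Hx {FHt} => [_ x Hx /(Hd x Hx)//|v t IHt Ht x Hx [c]].
rewrite -linearZ -linearB => hx; exists c; apply: IHt hx.
  by move=> u us; apply: Ht; rewrite inE us orbT.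
by apply: subspaceB => //; apply: subspaceZ => //; apply/Ht/mem_head.
Qed.

Lemma displaced_finite_of_cap H : displaced H ->
  finite_codim (H `&` (phi @` H)) H -> exists s, H `<=` hull [set 0] s.
Proof.
move=> Hd /finite_codimP[_ [s _ Hs]]; exists s => x /Hs.
apply: hull_mono => y [Hy [h Hh hy]]; rewrite -hy in Hy *.
by rewrite (Hd h Hh Hy) /= linear0.
Qed.

Lemma finite_codim_add_of_scalar k U H :
  subspace U -> finite_codim U setT -> acts_as_scalar phi k U -> subspace H ->
  finite_codim H (addsp H (phi @` H)).
Proof.
move=> sU Ufin Uk sH; apply/finite_codimP; split.
  by apply: addsp_subl; exact: subspace_image.
have /finite_codimP[_ [s sH' Hs]] := finite_codimI sU sH Ufin.
exists (map phi s) => [_ /mapP[v vs ->]|_ [x Hx [_ [y /Hs ys <-] <-]]].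
  by apply: (addsp_subr sH); exists v => //; apply: sH'.
apply: subspaceD; first exact: subspace_hull.
  exact: sub_hull.
apply: hull_mono (hull_image phi ys) => _ [u [Uu Hu] <-].
by rewrite Uk //; apply: subspaceZ.
Qed.

Lemma finite_codim_cap_of_scalar k U H : k != 0 ->
  subspace U -> finite_codim U setT -> acts_as_scalar phi k U -> subspace H ->
  finite_codim (H `&` (phi @` H)) H.
Proof.
move=> k0 sU Ufin Uk sH; apply: finite_codim_subl (finite_codimI sU sH Ufin).
  move=> x [Ux Hx]; split=> //; exists (k^-1 *: x); first exact: subspaceZ.
  by rewrite linearZ /= Uk // scalerA mulVf // scale1r.
exact: subIsetl.
Qed.

Lemma scalar_neq0 k U : ~ finite_dim V -> subspace U ->
  finite_codim U setT -> acts_as_scalar phi k U ->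
  finite_codim (U `&` (phi @` U)) U -> k != 0.
Proof.
move=> infV sU /finite_codimP[_ [s _ Us]] Uk /finite_codimP[_ [t _ Ut]].
apply/eqP => k0; apply/infV/(@finite_dim_hull _ _ (s ++ t)) => x.
rewrite hull_cat; apply: hull_mono (Us x I) => u /Ut.
by apply: hull_mono => _ [_ [w Uw <-]]; rewrite /= Uk // k0 scale0r.
Qed.

End Endomorphism.

Theorem theorem1 (K : fieldType) (V : lmodType K)
    (infV : ~ finite_dim V) (phi : {linear V -> V}) :
  ((forall H : set V, subspace H -> finite_codim H (addsp H (phi @` H)))
   <->
   (exists (k : K) (U : set V),
      [/\ subspace U, finite_codim U [set: V] & acts_as_scalar phi k U]))
  /\
  ((forall H : set V, subspace H -> finite_codim (H `&` (phi @` H)) H)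
   <->
   (exists (k : K) (U : set V),
      [/\ k != 0, subspace U, finite_codim U [set: V]
        & acts_as_scalar phi k U])).
Proof.
split; split.
- move=> fin; apply: scalar_on_finite_codim => // H sH Hd.
  exact: displaced_finite_of_add (fin H sH) sH.
- by move=> [k [U [sU Ufin Uk]]] H; apply: finite_codim_add_of_scalar Uk.
- move=> fin.
  have [|k [U [sU Ufin Uk]]] := @scalar_on_finite_codim _ _ phi infV.
    by move=> H sH Hd; apply: displaced_finite_of_cap (fin H sH).
  exists k, U; split=> //; exact: scalar_neq0 (fin U sU).
- by move=> [k [U [k0 sU Ufin Uk]]] H; apply: finite_codim_cap_of_scalar Uk.
Qed.
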